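(* Let $P^{\mathbb Q}$ be the group of all orientation preserving piecewise linear homeomorphisms of $[0,1]$ all of whose slopes and all of whose breaks lie in $\mathbb Q$. Then $P^{\mathbb Q}$ is invariably generated.
   Context: Piecewise linear homeomorphisms of $[0,1]$ have finitely many breaks, a break being a point of $(0,1)$ at which the map is not differentiable; the group operation is composition. A subgroup $H$ of a group $G$ is called classful if for every $g\in G$ some conjugate of $g$ in $G$ lies in $H$, equivalently $\bigcup_{g\in G} gHg^{-1}=G$. A group $G$ is invariably generated if it has no classful subgroup other than $G$ itself. *)

(* Defs.v *)
From HB Require Import structures.
From mathcomp Require Import all_boot all_order all_algebra.
From mathcomp Require Import ring lra.
From mathcomp Require Import all_classical all_reals all_analysis.

Set Implicit Arguments.
Unset Strict Implicit.
Unset Printing Implicit Defensive.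

Import Order.TTheory GRing.Theory Num.Theory.
Import numFieldNormedType.Exports.

Local Open Scope classical_set_scope.
Local Open Scope ring_scope.

Section InvariableGeneration.
Variable G : groupType.

Definition classful (H : {pred G}) : Prop :=
  forall g : G, exists x : G, (g ^ x)%g \in H.

Definition invariably_generated : Prop :=
  forall H : groupClosed G, classful H -> H =i predT.

End InvariableGeneration.

(* A homeomorphism of [0, 1] is extended to R by the identity outside [0, 1],
   so that equality of homeomorphisms is equality of functions on R. A
   bijection of R which is the identity outside [0, 1] maps [0, 1] onto itself.
   The extension is not required to be continuous at 0 and 1, so that
   orientation reversing homeomorphisms are included. *)
Record homeo01 (R : realType) := Homeo01 {
  homeo01_fun :> R -> R ;
  homeo01_inv : R -> R ;
  homeo01_funK : cancel homeo01_fun homeo01_inv ;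
  homeo01_invK : cancel homeo01_inv homeo01_fun ;
  homeo01_out : forall x, x \notin `[0, 1] -> homeo01_fun x = x ;
  homeo01_cts : {within `[0, 1], continuous homeo01_fun} ;
  homeo01_inv_cts : {within `[0, 1], continuous homeo01_inv} }.

HB.instance Definition _ (R : realType) := gen_eqMixin (homeo01 R).
HB.instance Definition _ (R : realType) := gen_choiceMixin (homeo01 R).

Section Homeo01Group.
Variable R : realType.
Implicit Types f g h : homeo01 R.

Lemma homeo01P f g : f =1 g -> f = g.
Proof.
case: f g => [f f' fK f'K fo fc f'c] [g g' gK g'K go gc g'c] /= /funext fg.
subst g; have E : f' = g'.
  by apply/funext => x; apply: (can_inj fK); rewrite f'K g'K.
subst g'; congr Homeo01; exact: Prop_irrelevance.
Qed.

Lemma homeo01_inv_out f x : x \notin `[0, 1] -> homeo01_inv f x = x.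
Proof. by move=> xo; rewrite -{1}(homeo01_out f xo) homeo01_funK. Qed.

Lemma homeo01_in f x : (f x \in `[0, 1]) = (x \in `[0, 1]).
Proof.
apply/idP/idP; apply: contraLR => xo.
  by rewrite (homeo01_out f xo).
have fE : f (f x) = f x by exact: homeo01_out.
by move: xo; rewrite (can_inj (homeo01_funK f) fE).
Qed.

Let within_comp (f g : R -> R) : (forall x, x \in `[0, 1] -> f x \in `[0, 1]) ->
  {within `[0, 1], continuous f} -> {within `[0, 1], continuous g} ->
  {within `[0, 1], continuous g \o f}.
Proof.
move=> f01 /subspace_continuousP fc /subspace_continuousP gc.
apply/subspace_continuousP => x x01.
apply: (@cvg_comp _ _ _ f g _ (within `[0, 1] (nbhs (f x)))); last first.
  exact/gc/f01.
move=> A /= fA; have /= := fc _ x01 _ fA.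
apply: (@filterS _ (nbhs x)) => t H t01; exact: H t01 (f01 _ t01).
Qed.

Let id_cts : {within `[0, 1], continuous (@id R)}.
Proof. by apply: continuous_subspaceT => x; exact: cvg_id. Qed.

Definition homeo01_one : homeo01 R :=
  @Homeo01 R id id (fun=> erefl) (fun=> erefl) (fun _ _ => erefl) id_cts id_cts.

Definition homeo01_inverse f : homeo01 R :=
  @Homeo01 R (homeo01_inv f) f (@homeo01_invK R f) (@homeo01_funK R f)
    (@homeo01_inv_out f) (@homeo01_inv_cts R f) (@homeo01_cts R f).

Let mul_out f g x : x \notin `[0, 1] -> (f \o g) x = x.
Proof. by move=> xo /=; rewrite (homeo01_out g xo) (homeo01_out f xo). Qed.

Let mul_cts f g : {within `[0, 1], continuous (f \o g)}.
Proof.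
apply: within_comp; [|exact: homeo01_cts|exact: homeo01_cts].
by move=> x; rewrite homeo01_in.
Qed.

Definition homeo01_mul f g : homeo01 R :=
  @Homeo01 R (f \o g) (homeo01_inv g \o homeo01_inv f)
    (can_comp (@homeo01_funK R f) (@homeo01_funK R g))
    (can_comp (@homeo01_invK R g) (@homeo01_invK R f))
    (@mul_out f g) (@mul_cts f g)
    (@mul_cts (homeo01_inverse g) (homeo01_inverse f)).

Let mulA : associative homeo01_mul.
Proof. by move=> f g h; exact: homeo01P. Qed.

Let mul1 : left_id homeo01_one homeo01_mul.
Proof. by move=> f; exact: homeo01P. Qed.

Let mulr1 : right_id homeo01_one homeo01_mul.
Proof. by move=> f; exact: homeo01P. Qed.

Let mulV : left_inverse homeo01_one homeo01_inverse homeo01_mul.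
Proof. by move=> f; apply: homeo01P => x; exact: homeo01_funK. Qed.

Let mulrV : right_inverse homeo01_one homeo01_inverse homeo01_mul.
Proof. by move=> f; apply: homeo01P => x; exact: homeo01_invK. Qed.

HB.instance Definition _ := isGroup.Build (homeo01 R)
  mulA mul1 mulr1 mulV mulrV.

Lemma homeo01_mulE f g : (f * g)%g = f \o g :> (R -> R). Proof. by []. Qed.

End Homeo01Group.

Section RationalPL.
Variable R : realType.
Implicit Types (f g : homeo01 R).

Definition orientation_preserving (f : R -> R) : Prop :=
  {in `[0, 1] &, {homo f : x y / x < y}}.

Definition affine_on (x y : R) (f : R -> R) : Prop :=
  exists a b : R, {in `[x, y], forall t, f t = a * t + b}.

(* s contains the division points of a finite subdivision of [0, 1] into
   intervals on each of which f is affine; points of s outside ]0, 1[ are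
   irrelevant. *)
Definition piecewise_linear (f : R -> R) : Prop :=
  exists s : seq R, forall x y, 0 <= x -> x < y -> y <= 1 ->
    {in s, forall z, z \notin `]x, y[} -> affine_on x y f.

(* At a point of ]0, 1[, derivability does not depend on the extension of f
   outside [0, 1]. *)
Definition breaks (f : R -> R) : set R :=
  [set x | 0 < x < 1 /\ ~ derivable f x 1].

(* Every linear piece has interior points, at which f is differentiable, so
   these are exactly the slopes of the linear pieces. *)
Definition slopes (f : R -> R) : set R :=
  [set a | exists2 x : R, 0 < x < 1 & is_derive x 1 f a].

Definition rationals : set R := range (@ratr R).

Definition is_PQ f : Prop :=
  [/\ orientation_preserving f, piecewise_linear f,
      slopes f `<=` rationals & breaks f `<=` rationals].

Definition PQ_pred : {pred homeo01 R} := fun f => `[< is_PQ f >].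

Section GroupClosed.

Local Notation Q := (@rationals).

Let Q0 : Q 0. Proof. by exists 0 => //; rewrite rmorph0. Qed.
Let Q1 : Q 1. Proof. by exists 1 => //; rewrite rmorph1. Qed.
Let QD x y : Q x -> Q y -> Q (x + y).
Proof. by case=> q _ <- [r _ <-]; exists (q + r) => //; rewrite rmorphD. Qed.
Let QB x y : Q x -> Q y -> Q (x - y).
Proof. by case=> q _ <- [r _ <-]; exists (q - r) => //; rewrite rmorphB. Qed.
Let QM x y : Q x -> Q y -> Q (x * y).
Proof. by case=> q _ <- [r _ <-]; exists (q * r) => //; rewrite rmorphM. Qed.
Let QV x : Q x -> Q x^-1.
Proof. by case=> q _ <-; exists q^-1 => //; rewrite fmorphV. Qed.

Let affine_derive (f : R -> R) (a b x y z : R) : x < z < y ->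
  {in `[x, y], forall t, f t = a * t + b} -> is_derive z 1 f a.
Proof.
move=> /andP[xz zy] fE.
have E : \near z, f z = a * z + b.
  near=> t; apply: fE; rewrite in_itv /=; apply/andP; split; apply: ltW.
    by near: t; exact: lt_nbhsr.
  by near: t; exact: lt_nbhsl.
have D : is_derive z 1 (fun t => a * t + b) a.
  apply: is_derive_eq; rewrite addr0; exact: mulr1.
apply: DeriveDef.
  apply: (near_eq_derivable _ (@ex_derive _ _ _ _ _ _ _ D)).
  by apply: filterS E => t ->.
by rewrite -[RHS](@derive_val _ _ _ _ _ _ _ D); exact: near_eq_derive.
Unshelve. all: by end_near. Qed.

Let affine_derive_r (f : R -> R) (a b c x y : R) : x < y ->
  {in `[x, y], forall t, f t = a * t + b} -> is_derive x 1 f c -> c = a.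
Proof.
move=> xy fE [df <-]; rewrite /derive cvg_at_rightE //.
apply: cvg_lim => //; apply: cvg_near_cst; near=> h.
have h0 : 0 < h by near: h; exact: nbhs_right_gt.
have hxy : h < y - x by near: h; apply: nbhs_right_lt; rewrite subr_gt0.
rewrite /GRing.scale /= mulr1 (fE (h + x)); last by rewrite in_itv /=; lra.
rewrite (fE x); last by rewrite in_itv /=; lra.
by field; exact: lt0r_neq0.
Unshelve. all: by end_near. Qed.

Let affine_derive_l (f : R -> R) (a b c x y : R) : x < y ->
  {in `[x, y], forall t, f t = a * t + b} -> is_derive y 1 f c -> c = a.
Proof.
move=> xy fE [df <-]; rewrite /derive cvg_at_leftE //.
apply: cvg_lim => //; apply: cvg_near_cst; near=> h.
have h0 : h < 0 by near: h; exact: nbhs_left_lt.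
have hxy : x - y < h by near: h; apply: nbhs_left_gt; rewrite subr_lt0.
rewrite /GRing.scale /= mulr1 (fE (h + y)); last by rewrite in_itv /=; lra.
rewrite (fE y); last by rewrite in_itv /=; lra.
by field; exact: ltr0_neq0.
Unshelve. all: by end_near. Qed.

Let gap (P : R -> Prop) (s : seq R) (f : R -> R) :=
  forall x y, 0 <= x -> x < y -> y <= 1 ->
  {in s, forall z, z \notin `]x, y[} ->
  exists a b : R, P a /\ {in `[x, y], forall t, f t = a * t + b}.

Let normal f := orientation_preserving f /\
  exists2 s : seq R, {in s, forall z, Q z} & gap Q s f.

Let gap_break f (s : seq R) : gap setT s f ->
  exists2 s' : seq R, {in s', forall z, breaks f z} & gap setT s' f.
Proof.
move=> gs; exists [seq z <- s | `[< breaks f z >]].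
  by move=> z; rewrite mem_filter => /andP[/asboolP].
suff H t : (forall z, z \in [seq z <- s | `[< breaks f z >]] -> z \in t) ->
    gap setT (t ++ s) f -> gap setT t f.
  by apply: H => // x y x0 xy y1 sH; apply: gs => // z zs; apply: sH;
    rewrite mem_cat zs orbT.
elim: s {gs} t => [|z s IH] t tH; first by rewrite cats0.
move=> gt; apply: IH => [u us|].
  by apply: tH; move: us; rewrite /= ; case: ifP => // _; rewrite inE orbC => ->.
move=> x y x0 xy y1 sH.
have [zxy|zxy] := boolP (z \in `]x, y[); last first.
  apply: gt => // u; rewrite mem_cat inE => /or3P[ut|/eqP-> //|us];
    by apply: sH; rewrite mem_cat ?ut ?us ?orbT.
have [/asboolP bz|/asboolP bz] := boolP `[< breaks f z >].
  have zt : z \in t by apply: tH => /=; rewrite asboolT // inE eqxx.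
  apply: gt => // u; rewrite mem_cat inE => /or3P[ut|/eqP->|us];
    by apply: sH; rewrite mem_cat ?zt ?ut ?us ?orbT.
move: (zxy); rewrite in_itv /= => /andP[xz zy].
have dz : is_derive z 1 f ('D_1 f z).
  apply: derivableP; apply: contrapT => dz; apply: bz; split=> //; lra.
have [||||a [b [_ fab]]] := gt x z => //; first lra.
  move=> u us; apply/negP; rewrite in_itv /= => /andP[xu uz].
  have : u \notin `]x, y[.
    move: us; rewrite mem_cat inE => /or3P[ut|/eqP uE|us]; last 2 first.
    - by move: uz; rewrite uE ltxx.
    - by apply: sH; rewrite mem_cat us orbT.
    by apply: sH; rewrite mem_cat ut.
  by rewrite in_itv /= xu (lt_trans uz zy).
have [||||c [d [_ fcd]]] := gt z y => //; first lra.
  move=> u us; apply/negP; rewrite in_itv /= => /andP[zu uy].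
  have : u \notin `]x, y[.
    move: us; rewrite mem_cat inE => /or3P[ut|/eqP uE|us]; last 2 first.
    - by move: zu; rewrite uE ltxx.
    - by apply: sH; rewrite mem_cat us orbT.
    by apply: sH; rewrite mem_cat ut.
  by rewrite in_itv /= uy (lt_trans xz zu).
have E1 := affine_derive_l xz fab dz.
have E2 := affine_derive_r zy fcd dz.
have ac : c = a by rewrite -E1 -E2.
have E3 : f z = a * z + b by apply: fab; rewrite in_itv /=; lra.
have E4 : f z = c * z + d by apply: fcd; rewrite in_itv /=; lra.
have db : d = b by move: E3; rewrite E4 ac => /addrI.
exists a, b; split=> // u; rewrite in_itv /= => /andP[xu uy].
have [uz|zu] := leP u z; first by apply: fab; rewrite in_itv /= xu uz.
by rewrite fcd ?ac ?db // in_itv /= uy ltW.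
Qed.

Let right_gap (s : seq R) (x : R) : x < 1 ->
  exists y, [/\ x < y, y <= 1 & {in s, forall z, z \notin `]x, y[}].
Proof.
move=> x1; elim: s => [|z s [y [xy y1 sH]]]; first by exists 1.
have [xz|zx] := ltP x z; last first.
  exists y; split=> // u; rewrite inE => /predU1P[->|/sH //].
  by rewrite in_itv /= ltNge zx.
exists (Num.min y z); split.
- by rewrite lt_min xy.
- by rewrite ge_min y1.
move=> u; rewrite in_itv /= lt_min inE => /predU1P[->|/sH].
  by rewrite ltxx !andbF.
by rewrite in_itv /=; apply: contra => /and3P[-> ->].
Qed.

Let left_gap (s : seq R) (x : R) : 0 < x ->
  exists y, [/\ y < x, 0 <= y & {in s, forall z, z \notin `]y, x[}].
Proof.
move=> x1; elim: s => [|z s [y [xy y1 sH]]]; first by exists 0.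
have [xz|zx] := ltP z x; last first.
  exists y; split=> // u; rewrite inE => /predU1P[->|/sH //].
  by rewrite in_itv /= [z < x]ltNge zx andbF.
exists (Num.max y z); split.
- by rewrite gt_max xy.
- by rewrite le_max y1.
move=> u; rewrite in_itv /= gt_max inE => /predU1P[->|/sH].
  by rewrite ltxx !andbF.
by rewrite in_itv /=; apply: contra => /andP[/andP[-> _] ->].
Qed.

Let is_PQ_normal f : is_PQ f <-> normal f.
Proof.
split.
  move=> [of_ [s gs] sf bf]; split=> //.
  have [|s' s'b gs'] := @gap_break f s.
    by move=> x y x0 xy y1 /(gs _ _ x0 xy y1) [a [b ab]]; exists a, b.
  exists s' => [z /s'b/bf //|x y x0 xy y1 /(gs' _ _ x0 xy y1) [a [b [_ ab]]]].
  exists a, b; split=> //; apply: sf; exists ((x + y) / 2); first lra.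
  by apply: affine_derive ab; lra.
move=> [of_ [s sQ gs]]; split=> //.
- by exists s => x y x0 xy y1 /(gs _ _ x0 xy y1) [a [b [_ ab]]]; exists a, b.
- move=> c [x /andP[x0 x1] dx].
  have [y [xy y1 /(gs _ _ (ltW x0) xy y1) [a [b [aQ ab]]]]] := right_gap s x1.
  by rewrite (affine_derive_r xy ab dx).
- move=> x [/andP[x0 x1] ndx]; apply: contrapT => nQx; apply: ndx.
  have [y [xy y1 yH]] := right_gap s x1.
  have [w [wx w0 wH]] := left_gap s x0.
  have [|a [b [_ ab]]] := gs w y w0 (lt_trans wx xy) y1.
    move=> z zs; rewrite in_itv /=; apply/negP => /andP[wz zy].
    have [zx|xz|zx] := ltgtP z x.
    - by have := wH _ zs; rewrite in_itv /= wz zx.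
    - by have := yH _ zs; rewrite in_itv /= xz zy.
    - by apply: nQx; rewrite -zx; exact: sQ.
  by have [] : is_derive x 1 f a by apply: affine_derive ab; rewrite wx xy.
Qed.

Let op0 f : orientation_preserving f -> f 0 = 0.
Proof.
move=> of_.
have fi x : x \in `[0, 1] -> homeo01_inv f x \in `[0, 1].
  by move=> x01; rewrite -(homeo01_in f) homeo01_invK.
have f00 : f 0 \in `[0, 1] by rewrite homeo01_in in_itv /= lexx ler01.
have i0 : homeo01_inv f 0 \in `[0, 1] by apply: fi; rewrite in_itv /= lexx ler01.
have [i00|i00] := eqVneq (homeo01_inv f 0) 0; first by rewrite -{1}i00 homeo01_invK.
have : f 0 < f (homeo01_inv f 0).
  apply: of_ => //; first by rewrite in_itv /= lexx ler01.
  by move: i0; rewrite in_itv /= lt_def i00 => /andP[->].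
by rewrite homeo01_invK; move: f00; rewrite in_itv /= => /andP[f00 _]; lra.
Qed.

Let normal_Q f x : normal f -> Q x -> Q (f x).
Proof.
move=> [of_ [s sQ gs]] Qx.
have [x01|x01] := boolP (x \in `[0, 1]); last by rewrite homeo01_out.
have H (t : seq R) p q : 0 <= p -> p < q -> q <= 1 -> Q p -> Q q ->
    {in s, forall z, z \in `]p, q[ -> z \in t} -> Q (f q - f p).
  elim: t p q => [|z t IH] p q p0 pq q1 Qp Qq tH.
    have [|a [b [Qa ab]]] := gs p q p0 pq q1.
      by move=> z zs; apply/negP => /(tH _ zs).
    rewrite !ab ?in_itv /= ?lexx ?(ltW pq) //.
    by rewrite (_ : _ - _ = a * (q - p)); [apply/QM/QB|ring].
  have [/andP[zs]|zpq] := boolP ((z \in s) && (z \in `]p, q[)); last first.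
    apply: IH => // u us upq; have := tH _ us upq.
    by rewrite inE => /predU1P[uz|//]; move: zpq; rewrite -uz us upq.
  rewrite in_itv /= => /andP[pz zq]; have Qz := sQ _ zs.
  have pzQ : Q (f z - f p).
    apply: IH => //; first lra.
    move=> u us; rewrite in_itv /= => /andP[pu uz].
    have := tH _ us; rewrite in_itv /= pu (lt_trans uz zq) => /(_ isT).
    by rewrite inE (lt_eqF uz).
  have zqQ : Q (f q - f z).
    apply: IH => //; first lra.
    move=> u us; rewrite in_itv /= => /andP[zu uq].
    have := tH _ us; rewrite in_itv /= uq (lt_trans pz zu) => /(_ isT).
    by rewrite inE (gt_eqF zu).
  by rewrite (_ : f q - f p = (f q - f z) + (f z - f p)); [apply: QD|ring].
have [->|x0] := eqVneq x 0; first by rewrite op0.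
have := x01; rewrite in_itv /= => /andP[x_ge0 x1].
rewrite -[f x]subr0 -(op0 of_); apply: (H s) => //.
by rewrite lt_def x0.
Qed.

Let mono_lt f : orientation_preserving f ->
  {in `[0, 1] &, {mono f : x y / x < y}}.
Proof.
move=> of_ x y x01 y01; apply/idP/idP; last exact: of_.
apply: contraTT; rewrite -!leNgt le_eqVlt => /predU1P[-> //|yx].
by apply: ltW; apply: of_.
Qed.

Let slope_neq0 f (x y a b : R) : 0 <= x -> x < y -> y <= 1 ->
  {in `[x, y], forall t, f t = a * t + b} -> a != 0.
Proof.
move=> x0 xy y1 ab; apply/eqP => a0.
have : f x = f y.
  by rewrite !ab ?in_itv /= ?lexx ?(ltW xy) // a0 !mul0r.
by move/(can_inj (@homeo01_funK R f))/eqP; rewrite (lt_eqF xy).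
Qed.

Let normal_inv f : normal f -> normal (homeo01_inverse f).
Proof.
move=> nf; have [of_ [s sQ gs]] := nf.
have fK := @homeo01_invK R f.
have fi x : x \in `[0, 1] -> homeo01_inv f x \in `[0, 1].
  by move=> x01; rewrite -(homeo01_in f) fK.
have oi : orientation_preserving (homeo01_inv f).
  by move=> x y x01 y01 xy; rewrite -(mono_lt of_) ?fi // !fK.
split=> //; exists (map f s).
  by move=> z /mapP[u us ->]; apply: normal_Q => //; exact: sQ.
move=> x y x0 xy y1 sH.
have x01 : x \in `[0, 1] by rewrite in_itv /=; lra.
have y01 : y \in `[0, 1] by rewrite in_itv /=; lra.
have xy' := oi _ _ x01 y01 xy.
have := fi _ x01; rewrite in_itv /= => /andP[x'0 _].
have := fi _ y01; rewrite in_itv /= => /andP[_ y'1].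
have [|a [b [Qa ab]]] := gs _ _ x'0 xy' y'1.
  move=> z zs; apply/negP; rewrite in_itv /= => /andP[xz zy].
  have z01 : z \in `[0, 1] by rewrite in_itv /=; lra.
  have := sH _ (map_f f zs); rewrite in_itv /= -{1}(fK x) -{1}(fK y).
  by rewrite !(mono_lt of_) ?fi // xz zy.
have a0 := slope_neq0 x'0 xy' y'1 ab.
exists a^-1, (- b / a); split; first exact: QV.
move=> t; rewrite in_itv /= => /andP[xt ty].
have t01 : t \in `[0, 1] by rewrite in_itv /=; lra.
have tE : t = a * homeo01_inv f t + b.
  by rewrite -ab ?fK // in_itv /= !(ltW_homo_in oi).
rewrite [in RHS]tE /=; set u := homeo01_inv f t.
by field.
Qed.

Let normal_mul f g : normal f -> normal g -> normal (f * g)%g.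
Proof.
move=> nf ng; have [of_ [s sQ gs]] := nf; have [og [r rQ gr]] := ng.
split.
  by move=> x y x01 y01 xy /=; apply: of_; rewrite ?homeo01_in //; exact: og.
exists (r ++ map (homeo01_inv g) s).
  move=> z; rewrite mem_cat => /orP[/rQ //|/mapP[u /sQ Qu ->]].
  exact: (normal_Q (normal_inv ng) Qu).
move=> x y x0 xy y1 H.
have x01 : x \in `[0, 1] by rewrite in_itv /=; lra.
have y01 : y \in `[0, 1] by rewrite in_itv /=; lra.
have [|c [d [Qc cd]]] := gr _ _ x0 xy y1.
  by move=> z zr; apply: H; rewrite mem_cat zr.
have gx01 : g x \in `[0, 1] by rewrite homeo01_in.
have gy01 : g y \in `[0, 1] by rewrite homeo01_in.
have [||||a [b [Qa ab]]] := gs (g x) (g y).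
- by move: gx01; rewrite in_itv /= => /andP[].
- exact: og.
- by move: gy01; rewrite in_itv /= => /andP[].
- move=> z zs; apply/negP; rewrite in_itv /= => /andP[xz zy].
  have z01 : z \in `[0, 1].
    by move: gx01 gy01; rewrite !in_itv /=; lra.
  have i01 : homeo01_inv g z \in `[0, 1].
    by rewrite -(homeo01_in g) homeo01_invK.
  have := H (homeo01_inv g z); rewrite mem_cat map_f // orbT => /(_ isT).
  by rewrite in_itv /= -(mono_lt og x01 i01) -(mono_lt og i01 y01) homeo01_invK xz zy.
exists (a * c), (a * d + b); split; first exact: QM.
move=> t; rewrite in_itv /= => /andP[xt ty].
have t01 : t \in `[0, 1] by rewrite in_itv /=; lra.
rewrite [LHS]/= ab; last first.
  by rewrite in_itv /= !(ltW_homo_in og).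
by rewrite cd ?in_itv /= ?xt //; ring.
Qed.

Let normal_one : normal 1%g.
Proof.
split=> //; exists [::] => // x y _ _ _ _.
by exists 1, 0; split=> // t _; rewrite mul1r addr0.
Qed.

Lemma PQ_group_closed : group_closed PQ_pred.
Proof.
split; first by apply/asboolP/is_PQ_normal; exact: normal_one.
move=> f g /asboolP/is_PQ_normal nf /asboolP/is_PQ_normal ng.
by apply/asboolP/is_PQ_normal/normal_mul => //; exact: normal_inv.
Qed.

End GroupClosed.

Record PQ := MkPQ { PQ_homeo :> homeo01 R ; PQ_homeoP : PQ_homeo \in PQ_pred }.

HB.instance Definition _ := [isSub for PQ_homeo].
HB.instance Definition _ := [Choice of PQ by <:].
HB.instance Definition _ := SubChoice_isSubGroup.Build _ _ PQ PQ_group_closed.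

End RationalPL.

(* Main.v *)
From HB Require Import structures.
Require Import Defs.
From mathcomp Require Import all_boot all_order all_algebra.
From mathcomp Require Import ring lra.
From mathcomp Require Import all_classical all_reals all_analysis.

Set Implicit Arguments.
Unset Strict Implicit.
Unset Printing Implicit Defensive.

Import Order.TTheory GRing.Theory Num.Theory.
Import numFieldNormedType.Exports.

Local Open Scope classical_set_scope.
Local Open Scope ring_scope.

(* Let H be a classful subgroup of G = PQ R. For p rational in [0, 1) and l
   < 1 rational, G contains elements trivial on [0, p], of right slope l at
   p, contracting (p, 1) towards p. Conjugates of those lie in H. As the
   slopes at 0 of elements of H take all positive rational values,
   conjugating by powers of a contraction gives in H all rational
   homotheties on a fixed interval [0, E]; hence H is transitive on the
   rationals of (0, 1), and contains such contractions at every rational p.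
   These allow one to glue two elements of H which agree at p: one left of
   p, the other on [p, q], for any q < 1. Homotheties with two distinct
   centers generate all rational affine maps between subintervals of a small
   interval, and every interval of (0, 1) is moved piecewise affinely there
   by H; so, by gluing, every element of G agrees on [0, q] with an element
   of H. Then H contains each c trivial near 1, since the conjugate of c in
   H can be conjugated back within H. Finally g^x g^-1 is trivial near 1 for
   all g and x, and some g^x is in H. *)

(** * Rational real numbers *)

Section Rationals.
Variable R : realType.

Definition ratnum : {pred R} := fun x => `[< rationals x >].

Lemma ratnumP x : reflect (rationals x) (x \in ratnum).
Proof. exact: asboolP. Qed.

Lemma ratnum_divring_closed : divring_closed ratnum.
Proof.
split=> [|x y /ratnumP[q _ <-] /ratnumP[r _ <-]|x y /ratnumP[q _ <-] /ratnumP[r _ <-]].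
- by apply/ratnumP; exists 1 => //; rewrite rmorph1.
- by apply/ratnumP; exists (q - r) => //; rewrite rmorphB.
- by apply/ratnumP; exists (q / r) => //; rewrite fmorph_div.
Qed.

HB.instance Definition _ :=
  GRing.isDivringClosed.Build R ratnum ratnum_divring_closed.

Lemma ratnum_between (x y : R) : x < y -> exists2 z, z \in ratnum & x < z < y.
Proof.
move=> /rat_in_itvoo[q]; rewrite in_itv => xqy.
by exists (ratr q) => //; apply/ratnumP; exists q.
Qed.

End Rationals.

Arguments ratnum {R}.

(** * Finite subdivisions of intervals *)

Section Gaps.
Variable R : realType.
Implicit Types (s : seq R) (x y z : R).

(** Division points form an unordered list: an interval lies within one piece when its interior
    misses the list. *)
Definition gap s x y := {in s, forall z, z \notin `]x, y[}.

Lemma gap_cat s1 s2 x y : gap (s1 ++ s2) x y <-> gap s1 x y /\ gap s2 x y.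
Proof.
split=> [g|[g1 g2] z]; last by rewrite mem_cat => /orP[/g1|/g2].
by split=> z zs; apply: g; rewrite mem_cat zs ?orbT.
Qed.

Lemma gap_ind s (P : R -> R -> Prop) :
  (forall x z y, z \in s -> x < z -> z < y -> P x z -> P z y -> P x y) ->
  (forall x y, x < y -> gap s x y -> P x y) ->
  forall x y, x < y -> P x y.
Proof.
move=> Pm Pg x y xy.
suff H (t : seq R) : {in s, forall z, z \in `]x, y[ -> z \in t} -> P x y.
  by apply: (H s).
elim: t x y xy => [|u t IH] x y xy sH.
  by apply: Pg => // z /sH; case: (z \in _) => // /(_ isT).
have [/andP[us]|uxy] := boolP ((u \in s) && (u \in `]x, y[)); last first.
  apply: IH => // z zs zxy; have := sH z zs zxy; rewrite inE => /predU1P[zu|//].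
  by move: uxy; rewrite -zu zs zxy.
rewrite in_itv /= => /andP[xu uy]; apply: (Pm x u y) => //; apply: IH => // z zs.
  rewrite in_itv /= => /andP[xz zu]; have := sH z zs.
  by rewrite in_itv /= xz (lt_trans zu uy) inE (lt_eqF zu) => /(_ isT).
rewrite in_itv /= => /andP[uz zy]; have := sH z zs.
by rewrite in_itv /= zy (lt_trans xu uz) inE (gt_eqF uz) => /(_ isT).
Qed.

Lemma right_gap s x : exists2 y, x < y & gap s x y.
Proof.
elim: s => [|z s [y xy sH]]; first by exists (x + 1) => //; rewrite ltrDl.
have [xz|zx] := ltP x z; last first.
  by exists y => // u; rewrite inE => /predU1P[->|/sH //]; rewrite in_itv /= ltNge zx.
exists (Num.min y z); first by rewrite lt_min xy.
move=> u; rewrite in_itv /= lt_min inE => /predU1P[->|/sH]; first by rewrite ltxx !andbF.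
by rewrite in_itv /=; apply: contra => /and3P[-> ->].
Qed.

Lemma left_gap s x : exists2 y, y < x & gap s y x.
Proof.
have [y xy g] := right_gap [seq - z | z <- s] (- x).
exists (- y) => [|z zs]; first by rewrite ltrNl.
have := g (- z) (map_f _ zs); rewrite !in_itv /= ltrN2.
by rewrite [- z < y]ltrNl andbC.
Qed.

Lemma mesh (e : R) : e \in ratnum -> 0 < e ->
  exists2 s, {in s, forall z, z \in ratnum} &
    forall x y, 0 <= x -> x < y -> y <= 1 -> gap s x y -> y <= x + e.
Proof.
move=> eQ e0; exists [seq e *+ k | k <- iota 0 (Num.truncn e^-1).+1].
  by move=> z /mapP[k _ ->]; rewrite rpredMn.
move=> x y x0 xy y1 g; rewrite leNgt; apply/negP => xey.
have /truncn_itv/andP[kl kr] : 0 <= x / e by rewrite divr_ge0 // ltW.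
set k := Num.truncn _ in kl kr.
have kx : k%:R * e <= x by rewrite -ler_pdivlMr.
have xk : x < k.+1%:R * e by rewrite -ltr_pdivrMr.
have ky : k.+1%:R * e < y by rewrite -natr1 mulrDl mul1r; lra.
have /g : e *+ k.+1 \in [seq e *+ k | k <- iota 0 (Num.truncn e^-1).+1].
  apply: map_f; rewrite mem_iota /= add0n -(ltr_nat R).
  apply: lt_trans (truncnS_gt _).
  by rewrite -[e^-1]mul1r ltr_pdivlMr //; apply: lt_le_trans ky y1.
by rewrite in_itv /= -mulr_natl ky xk.
Qed.

End Gaps.

(** * Slopes and pieces *)

Section Slopes.
Variable R : realType.
Implicit Types (f : R -> R) (a b c x y z : R).

Lemma affine_is_derive f a b x y z : x < z < y ->
  {in `[x, y], forall t, f t = a * t + b} -> is_derive z 1 f a.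
Proof.
move=> /andP[xz zy] fE.
have E : \near z, a * z + b = f z.
  near=> t; apply/esym/fE; rewrite in_itv /=; apply/andP; split; apply: ltW.
    by near: t; exact: lt_nbhsr.
  by near: t; exact: lt_nbhsl.
suff D : is_derive z 1 (fun t => a * t + b) a by exact: near_eq_is_derive D.
by apply: is_derive_eq; rewrite addr0; exact: mulr1.
Unshelve. all: by end_near. Qed.

Lemma affine_slope f a b c x y z : x < y -> x <= z <= y ->
  {in `[x, y], forall t, f t = a * t + b} -> is_derive z 1 f c -> c = a.
Proof.
move=> xy /andP[xz zy] fE [df <-]; apply/eqP/contraT => neq.
move/cvgrPdist_lt: df => /(_ `|'D_1 f z - a|); rewrite normr_gt0 subr_eq0 => /(_ neq).
move=> /nbhs_ballP[d /= d0 H].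
(* As [z] may be an endpoint, the increment goes right if [z < y] and left otherwise. *)
have [h h0 [hd hx hy]] : exists2 h : R, h != 0 & [/\ `|h| < d, x <= z + h & z + h <= y].
  have [zy'|yz] := ltP z y.
    have m0 : 0 < Num.min (d / 2) (y - z) by rewrite lt_min subr_gt0 zy' divr_gt0.
    exists (Num.min (d / 2) (y - z)); first by rewrite gt_eqF.
    rewrite gtr0_norm //; split; last 2 first.
    - lra.
    - by rewrite -lerBrDl ge_min lexx orbT.
    by rewrite gt_min; apply/orP; left; lra.
  have m0 : 0 < Num.min (d / 2) (y - x) by rewrite lt_min subr_gt0 xy divr_gt0.
  exists (- Num.min (d / 2) (y - x)); first by rewrite oppr_eq0 gt_eqF.
  rewrite normrN gtr0_norm //; split; last 2 first.
  - have : Num.min (d / 2) (y - x) <= y - x by rewrite ge_min lexx orbT.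
    lra.
  - lra.
  by rewrite gt_min; apply/orP; left; lra.
have hb : ball 0 d h by rewrite /ball /= sub0r normrN.
have E : h^-1 * (f (h * 1 + z) - f z) = a.
  rewrite mulr1 (fE (h + z)) ?(fE z) ?in_itv /= ?xz ?zy // 1?addrC ?hx //.
  by field.
suff : `|'D_1 f z - a| < `|'D_1 f z - a| by rewrite ltxx.
by rewrite -{1}E; exact: (H h hb h0).
Qed.

(** The derivative at [z] is the slope on both sides, and the value at [z] then identifies the
    constants. *)
Lemma affine_merge f x y z : x < z -> z < y -> derivable f z 1 ->
  affine_on x z f -> affine_on z y f -> affine_on x y f.
Proof.
move=> xz zy /derivableP df [a [b ab]] [c [d cd]].
have Da := affine_slope xz _ ab df; have Dc := affine_slope zy _ cd df.
have {Dc}ca : c = a by rewrite -Da ?Dc ?lexx ?ltW.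
have bd : d = b.
  have := cd z; rewrite (ab z) ?in_itv /= ?lexx ?ltW // ca => /(_ isT) /addrI.
  exact: esym.
exists a, b => t; rewrite in_itv /= => /andP[xt ty].
have [tz|zt] := leP t z; first by rewrite ab // in_itv /= xt.
by rewrite cd ?ca ?bd // in_itv /= ty ltW.
Qed.

Lemma orientation_preserving_mono (f : homeo01 R) :
  orientation_preserving f -> {mono f : x y / x <= y}.
Proof.
move=> of_; apply: le_mono => x y xy.
have [x01|x01] := boolP (x \in `[0, 1]); have [y01|y01] := boolP (y \in `[0, 1]).
- exact: of_.
- have := x01; rewrite (homeo01_out f y01) -(homeo01_in f).
  by move: x01 y01 xy; rewrite !in_itv /= negb_and -!ltNge => ? /orP[]; lra.
- have := y01; rewrite (homeo01_out f x01) -(homeo01_in f).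
  by move: y01 x01 xy; rewrite !in_itv /= negb_and -!ltNge => ? /orP[]; lra.
- by rewrite !homeo01_out.
Qed.

(** An irrational division point is not a break, so the pieces around it merge and it can be
    discarded. Adding 0 and 1 to the list separates off the outside of [[0, 1]], where [f] is the
    identity. A slope is rational as the derivative at the midpoint of a piece. *)
Lemma is_PQ_pieces (f : homeo01 R) : is_PQ f ->
  exists2 s, {in s, forall z, z \in ratnum} &
    forall x y, x < y -> gap s x y ->
    exists a b, a \in ratnum /\ {in `[x, y], forall t, f t = a * t + b}.
Proof.
move=> [of_ [s sP] slQ brQ].
pose s' := [seq z <- s | z \in ratnum].
have aff x y : 0 <= x -> x < y -> y <= 1 -> gap s' x y -> affine_on x y f.
  move=> x0 xy; move: x y xy x0.
  apply: (@gap_ind R s (fun x y => 0 <= x -> y <= 1 -> gap s' x y -> affine_on x y f)).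
    move=> x z y zs xz zy IHx IHy x0 y1 g; apply: (affine_merge xz zy).
    - apply: contrapT => nd.
      have /ratnumP zQ : rationals z.
        by apply: brQ; split=> //; rewrite (le_lt_trans x0 xz) (lt_le_trans zy y1).
      have /g : z \in s' by rewrite mem_filter zQ.
      by rewrite in_itv /= xz zy.
    - apply: IHx => //; first by rewrite (le_trans (ltW zy)).
      move=> u /g; rewrite !in_itv /=; apply: contra => /andP[-> uz].
      exact: lt_trans uz zy.
    - apply: IHy => //; first by rewrite (le_trans x0) // ltW.
      move=> u /g; rewrite !in_itv /=; apply: contra => /andP[zu ->].
      by rewrite (lt_trans xz zu).
  by move=> x y xy g x0 y1 _; exact: sP.
exists (0 :: 1 :: s') => [z|x y xy g].
  rewrite !in_cons => /or3P[/eqP->|/eqP->|]; rewrite ?rpred0 ?rpred1 //.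
  by rewrite mem_filter => /andP[].
have f0 : f 0 = 0.
  apply/eqP; rewrite eq_le; apply/andP; split; last first.
    by have := homeo01_in f 0; rewrite !in_itv /= lexx ler01 => /andP[].
  rewrite -[leRHS](homeo01_invK f) (orientation_preserving_mono of_).
  have := homeo01_in f (homeo01_inv f 0).
  by rewrite homeo01_invK !in_itv /= lexx ler01 => /esym/andP[].
have f1 : f 1 = 1.
  apply/eqP; rewrite eq_le; apply/andP; split.
    by have := homeo01_in f 1; rewrite !in_itv /= lexx ler01 => /andP[].
  rewrite -[leLHS](homeo01_invK f) (orientation_preserving_mono of_).
  have := homeo01_in f (homeo01_inv f 1).
  by rewrite homeo01_invK !in_itv /= lexx ler01 => /esym/andP[].
have {}g z : z \in 0 :: 1 :: s' -> z <= x \/ y <= z.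
  by move=> /g; rewrite in_itv /= negb_and -!leNgt => /orP.
have out : y <= 0 \/ 1 <= x -> exists a b : R,
    a \in ratnum /\ {in `[x, y], forall t, f t = a * t + b}.
  move=> xy01; exists 1, 0; rewrite rpred1; split=> // t; rewrite in_itv /= => txy.
  rewrite mul1r addr0; have [->//|t0] := eqVneq t 0; have [->//|t1] := eqVneq t 1.
  by apply: homeo01_out; rewrite in_itv /=; case: xy01; move/eqP: t0; move/eqP: t1; lra.
have [x0|y0] := g 0 (mem_head _ _); last by apply: out; left.
have [x1|y1] := g 1 (@mem_behead _ (0 :: 1 :: s') _ (mem_head 1 s')).
  by apply: out; right.
have [|a [b ab]] := aff x y x0 xy y1.
  move=> z zs; rewrite in_itv /= negb_and -!leNgt; apply/orP/g.
  by rewrite !in_cons zs !orbT.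
exists a, b; split=> //; apply/ratnumP/slQ; exists ((x + y) / 2); first lra.
by apply: affine_is_derive ab; lra.
Qed.

Lemma pieces_is_PQ (f : homeo01 R) (s : seq R) : orientation_preserving f ->
  {in s, forall z, z \in ratnum} ->
  (forall x y, x < y -> gap s x y ->
     exists a b, a \in ratnum /\ {in `[x, y], forall t, f t = a * t + b}) ->
  is_PQ f.
Proof.
move=> of_ sQ sP; split=> //.
- by exists s => x y _ xy _ /(sP x y xy)[a [b [_ ab]]]; exists a, b.
- move=> c [x x01 dx]; have [y xy /(sP x y xy)[a [b [aQ ab]]]] := right_gap s x.
  by rewrite (affine_slope xy _ ab dx) ?lexx ?ltW //; exact/ratnumP.
- move=> x [x01 ndx]; apply: contrapT => /ratnumP nQx; apply: ndx.
  (* [x], being irrational, is not in [s], so the gaps on its two sides join into a single affine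
     piece. *)
  have [y xy yH] := right_gap s x; have [w wx wH] := left_gap s x.
  have [||a [b [_ ab]]] := sP w y; first exact: lt_trans xy.
    move=> z zs; rewrite in_itv /=; apply/negP => /andP[wz zy].
    have [zx|xz|zx] := ltgtP z x.
    - by have := wH z zs; rewrite in_itv /= wz zx.
    - by have := yH z zs; rewrite in_itv /= xz zy.
    - by move: nQx; rewrite -zx sQ.
  by have [] : is_derive x 1 f a by apply: affine_is_derive ab; rewrite wx xy.
Qed.

End Slopes.

(** * An explicit contraction of [(p, 1)] towards [p] *)

Section Bend.
Variables (R : realType) (p l : R).
Hypotheses (pQ : p \in ratnum) (lQ : l \in ratnum).
Hypotheses (p0 : 0 <= p) (p1 : p < 1) (l0 : 0 < l) (l1 : l < 1).
Implicit Types x y : R.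

(** The slopes [l] and [2 - l] have mean 1, so changing slope at the midpoint of [[p, 1]] makes the
    map fix 1. *)
Let m := (1 + p) / 2.

(* Slope 1 on [0, p], then l up to the midpoint of [p, 1], then 2 - l. *)
Definition bend x := Num.min x (Num.max (p + l * (x - p)) (1 - (2 - l) * (1 - x))).

Definition bend_inv y :=
  Num.max y (Num.min (p + (y - p) / l) (1 - (1 - y) / (2 - l))).

Let l2 : 0 < 2 - l. Proof. by move: l1; lra. Qed.

(** Each affine branch satisfies such an equivalence with its inverse, and inversion exchanges
    [Num.min] and [Num.max]. Together with the strict version this gives both cancellations. *)
Lemma bend_leE x y : (y <= bend x) = (bend_inv y <= x).
Proof.
rewrite le_min le_max ge_max ge_min; congr (_ && (_ || _)).
  by rewrite -lerBlDl -ler_pdivrMl // [l^-1 * _]mulrC lerBrDl.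
by rewrite lerBrDl -lerBrDr mulrC -ler_pdivlMr // lerBlDl -lerBlDr.
Qed.

Lemma bend_ltE x y : (y < bend x) = (bend_inv y < x).
Proof.
rewrite lt_min lt_max gt_max gt_min; congr (_ && (_ || _)).
  by rewrite -ltrBlDl -ltr_pdivrMl // [l^-1 * _]mulrC ltrBrDl.
by rewrite ltrBrDl -ltrBrDr mulrC -ltr_pdivlMr // ltrBlDl -ltrBlDr.
Qed.

Lemma bendK : cancel bend bend_inv.
Proof. by move=> x; apply/eqP; rewrite eq_le -bend_leE lexx leNgt -bend_ltE ltxx. Qed.

Lemma bend_invK : cancel bend_inv bend.
Proof. by move=> y; apply/eqP; rewrite eq_le bend_leE lexx leNgt bend_ltE ltxx. Qed.

Lemma bend_lt : {mono bend : x y / x < y}.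
Proof. by move=> x y; rewrite bend_ltE bendK. Qed.

Lemma bend_out x : x <= p \/ 1 <= x -> bend x = x.
Proof.
have := p0; have := p1; have := l0; have := l1 => l1' l0' p1' p0'.
move=> xp; apply/min_idPl; rewrite le_max; apply/orP.
case: xp => [xp|x1]; [left|right].
  have : 0 <= (1 - l) * (p - x) by apply: mulr_ge0; lra.
  lra.
have : 0 <= (1 - l) * (x - 1) by apply: mulr_ge0; lra.
lra.
Qed.

Lemma bend_mid x : p <= x -> x <= m -> bend x = p + l * (x - p).
Proof.
have := p0; have := p1; have := l0; have := l1 => l1' l0' p1' p0'.
rewrite /m => px xm.
have : 0 <= (1 - l) * (x - p) by apply: mulr_ge0; lra.
have : 0 <= (1 - l) * ((1 + p) / 2 - x) by apply: mulr_ge0; lra.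
by move=> ? ?; rewrite /bend max_l ?min_r //; lra.
Qed.

Lemma bend_end x : m <= x -> x <= 1 -> bend x = 1 - (2 - l) * (1 - x).
Proof.
have := p0; have := p1; have := l0; have := l1 => l1' l0' p1' p0'.
rewrite /m => mx x1.
have : 0 <= (1 - l) * (1 - x) by apply: mulr_ge0; lra.
have : 0 <= (1 - l) * (x - (1 + p) / 2) by apply: mulr_ge0; lra.
by move=> ? ?; rewrite /bend max_r ?min_r //; lra.
Qed.

Lemma bend_contracts x : p < x -> x < 1 -> bend x < x.
Proof.
have := p0; have := p1; have := l0; have := l1 => l1' l0' p1' p0'.
move=> px x1; rewrite gt_min ltxx gt_max /=; apply/andP; split.
  have : 0 < (1 - l) * (x - p) by apply: mulr_gt0; lra.
  lra.
have : 0 < (1 - l) * (1 - x) by apply: mulr_gt0; lra.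
lra.
Qed.

Let homeo_out x : x \notin `[0, 1] -> bend x = x.
Proof.
rewrite in_itv /= negb_and -!ltNge => /orP x01; apply: bend_out.
by move: p0; case: x01 => ? ?; [left|right]; lra.
Qed.

Let bend_cts : {within `[0, 1], continuous bend}.
Proof.
apply: continuous_subspaceT => x.
apply: (@continuous_min R R id (fun t => Num.max _ _)); first exact: cvg_id.
apply: (@continuous_max R R (fun t => _ + _) (fun t => _ - _)).
  by apply: cvgD; [exact: cvg_cst|
    apply: cvgM; [exact: cvg_cst|apply: cvgB; [exact: cvg_id|exact: cvg_cst]]].
by apply: cvgB; [exact: cvg_cst|
    apply: cvgM; [exact: cvg_cst|apply: cvgB; [exact: cvg_cst|exact: cvg_id]]].
Qed.

Let bend_inv_cts : {within `[0, 1], continuous bend_inv}.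
Proof.
apply: continuous_subspaceT => x.
apply: (@continuous_max R R id (fun t => Num.min _ _)); first exact: cvg_id.
apply: (@continuous_min R R (fun t => _ + _) (fun t => _ - _)).
  by apply: cvgD; [exact: cvg_cst|
    apply: cvgM; [apply: cvgB; [exact: cvg_id|exact: cvg_cst]|exact: cvg_cst]].
by apply: cvgB; [exact: cvg_cst|
    apply: cvgM; [apply: cvgB; [exact: cvg_cst|exact: cvg_id]|exact: cvg_cst]].
Qed.

Definition bend_homeo := Homeo01 bendK bend_invK homeo_out bend_cts bend_inv_cts.

Lemma bend_PQ : bend_homeo \in PQ_pred (R := R).
Proof.
apply/asboolP; apply: (@pieces_is_PQ _ _ [:: p; m; 1]).
- by move=> x y _ _ xy /=; rewrite bend_lt.
- move=> z; rewrite !in_cons orbF => /or3P[]/eqP-> //; last exact: rpred1.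
  by rewrite rpred_div ?rpredD ?rpred1 ?rpred_nat.
move=> x y xy g.
have {}g z : z \in [:: p; m; 1] -> z <= x \/ y <= z.
  by move=> /g; rewrite in_itv /= negb_and -!leNgt => /orP.
have gp := g p (mem_head _ _).
have gm : m <= x \/ y <= m by apply: g; rewrite !inE eqxx orbT.
have g1 : 1 <= x \/ y <= 1 by apply: g; rewrite !inE eqxx !orbT.
have id_out : y <= p \/ 1 <= x ->
    exists a b, a \in ratnum /\ {in `[x, y], forall t, bend t = a * t + b}.
  move=> xy1; exists 1, 0; rewrite rpred1; split=> // t; rewrite in_itv /= => /andP[xt ty].
  by rewrite mul1r addr0 bend_out //; case: xy1 => ?; [left|right]; lra.
case: gp => [px|yp]; last by apply: id_out; left.
case: g1 => [x1|y1]; first by apply: id_out; right.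
case: gm => [mx|ym].
  exists (2 - l), (1 - (2 - l)); rewrite rpredB ?rpred_nat //; split=> // t.
  by rewrite in_itv /= => /andP[xt ty]; rewrite bend_end; first ring; lra.
exists l, (p - l * p); split=> // t.
by rewrite in_itv /= => /andP[xt ty]; rewrite bend_mid; first ring; lra.
Qed.

End Bend.

(** * Elements of the group *)

Section PQElements.
Variable R : realType.
Implicit Types (f g h : PQ R) (a b l p q t x y z d e : R).

Lemma PQ_M f g x : (f * g)%g x = f (g x). Proof. by []. Qed.

Lemma PQ_1 x : (1%g : PQ R) x = x. Proof. by []. Qed.

Lemma PQ_K g : cancel g (g^-1)%g.
Proof. by move=> x; rewrite -PQ_M mulVg. Qed.

Lemma PQ_VK g : cancel (g^-1)%g g.
Proof. by move=> x; rewrite -PQ_M mulgV. Qed.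

Lemma PQ_ext f g : f =1 g -> f = g.
Proof. by move=> fg; apply/val_inj/homeo01P. Qed.

Lemma PQ_isP g : is_PQ g. Proof. by have /asboolP := PQ_homeoP g. Qed.

Lemma PQ_le g : {mono g : x y / x <= y}.
Proof. by apply: orientation_preserving_mono; have [] := PQ_isP g. Qed.

Lemma PQ_lt g : {mono g : x y / x < y}.
Proof. exact: leW_mono (PQ_le g). Qed.

Lemma PQ_out g x : x <= 0 \/ 1 <= x -> g x = x.
Proof.
have g01 f : 0 <= f 0 /\ f 1 <= 1.
  have := homeo01_in f 0; have := homeo01_in f 1.
  by rewrite !in_itv /= !lexx ler01 => /andP[_ ->] /andP[-> _].
have [x01|x01 _] := boolP (x \in `[0, 1]); last exact: homeo01_out.
move: x01; rewrite in_itv /= => /andP[x0 x1] [x0'|x1'].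
  have -> : x = 0 by lra.
  apply/eqP; rewrite eq_le (g01 g).1 andbT -[leRHS](PQ_VK g) PQ_le.
  by rewrite (g01 _).1.
have -> : x = 1 by lra.
apply/eqP; rewrite eq_le (g01 g).2 /= -[leLHS](PQ_VK g) PQ_le.
by rewrite (g01 _).2.
Qed.

Lemma PQ_fix0 g : g 0 = 0. Proof. by apply: PQ_out; left. Qed.

Lemma PQ_fix1 g : g 1 = 1. Proof. by apply: PQ_out; right. Qed.

Lemma PQ_pieces g : exists2 s, {in s, forall z, z \in ratnum} &
  forall x y, x < y -> gap s x y -> exists a b,
    [/\ a \in ratnum, 0 < a & {in `[x, y], forall t, g t = a * t + b}].
Proof.
have [s sQ sP] := is_PQ_pieces (PQ_isP g); exists s => // x y xy.
move=> /(sP x y xy)[a [b [aQ ab]]]; exists a, b; split=> //.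
have : g x < g y by rewrite PQ_lt.
rewrite !ab ?in_itv /= ?lexx ?ltW // ltrD2r -subr_gt0 -mulrBr.
by rewrite pmulr_lgt0 // subr_gt0.
Qed.

(** On a piece with rational ends the increment of [g] is a rational slope times a rational length;
    these increments add up from 0. *)
Lemma PQ_rat g x : x \in ratnum -> g x \in ratnum.
Proof.
have [s sQ sP] := PQ_pieces g => xQ.
have [x0|x0] := leP x 0; first by rewrite PQ_out //; left.
suff : g x - g 0 \in ratnum by rewrite PQ_fix0 subr0.
suff H : forall u v, u < v -> u \in ratnum -> v \in ratnum -> g v - g u \in ratnum.
  by apply: H => //; exact: rpred0.
apply: (@gap_ind R s) => [x' z y|].
  move=> /sQ zQ xz zy IHx IHy xQ' yQ.
  by rewrite -(subrKA (g z)) rpredD // ?IHx ?IHy.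
move=> u v uv /(sP u v uv)[a [b [aQ _ ab]]] uQ vQ.
rewrite !ab ?in_itv /= ?lexx ?ltW // (_ : _ - _ = a * (v - u)); last ring.
by rewrite rpredM // rpredB.
Qed.

(** Exact equality on an initial segment: this records the whole germ of [g] right of [p], also when
    [p] is a break or 0. *)
Definition rslope (g : R -> R) p a :=
  exists2 d, 0 < d & forall t, 0 <= t <= d -> g (p + t) = g p + a * t.

Lemma rslopeM f g p a b : 0 < b ->
  rslope f (g p) a -> rslope g p b -> rslope (f * g)%g p (a * b).
Proof.
move=> b0 [d d0 fE] [e e0 gE]; exists (Num.min e (d / b)).
  by rewrite lt_min e0 divr_gt0.
move=> t; rewrite le_min => /and3P[t0 te td].
rewrite !PQ_M gE ?t0 // fE ?mulrA // mulr_ge0 ?(ltW b0) //=.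
by rewrite mulrC -ler_pdivlMr.
Qed.

Lemma rslopeV g p a : 0 < a -> rslope g p a -> rslope (g^-1)%g (g p) a^-1.
Proof.
move=> a0 [d d0 gE]; exists (a * d); first exact: mulr_gt0.
move=> t /andP[t0 td]; rewrite PQ_K -[in LHS](mulVKf (lt0r_neq0 a0) t).
rewrite -gE ?PQ_K // mulr_ge0 ?invr_ge0 ?(ltW a0) //=.
by rewrite ler_pdivrMl.
Qed.

Lemma PQ_rslope g p : exists a, [/\ a \in ratnum, 0 < a & rslope g p a].
Proof.
have [s _ sP] := PQ_pieces g; have [y py] := right_gap s p.
move=> /(sP p y py)[a [b [aQ a0 ab]]]; exists a; split=> //.
exists (y - p); first by rewrite subr_gt0.
move=> t /andP[t0 ty]; rewrite !ab ?in_itv /=; first ring.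
  by rewrite lexx ltW.
by rewrite lerDl t0 -lerBrDl.
Qed.

Lemma PQ_lslope1 g :
  exists a d, [/\ 0 < a, 0 < d & forall t, 0 <= t <= d -> g (1 - t) = 1 - a * t].
Proof.
have [s _ sP] := PQ_pieces g; have [y y1] := left_gap s 1.
move=> /(sP y 1 y1)[a [b [_ a0 ab]]]; exists a, (1 - y); split=> //.
  by rewrite subr_gt0.
have b1 : a * 1 + b = 1 by rewrite -ab ?PQ_fix1 // in_itv /= lexx ltW.
move=> t /andP[t0 ty]; rewrite ab; last by rewrite in_itv /=; lra.
by rewrite -[X in _ = X - _]b1; ring.
Qed.

Lemma expgM1 h n x : (h ^+ n.+1)%g x = h ((h ^+ n)%g x).
Proof. by rewrite expgS. Qed.

Definition contracts h p l := [/\ forall x, x <= p -> h x = x,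
  forall x, p < x -> x < 1 -> h x < x & rslope h p l].

(** The right slopes of [g] at [q] and of [g^-1] at [g q] cancel, because [h] fixes [g q]. *)
Lemma contractsJ h g q l : 0 < l -> contracts h (g q) l -> contracts (h ^ g)%g q l.
Proof.
move=> l0 [hid hc hl]; rewrite conjgE; split=> [x xq|x qx x1|].
- by rewrite !PQ_M hid ?PQ_K // PQ_le.
- rewrite !PQ_M -[ltRHS](PQ_K g) PQ_lt hc // ?PQ_lt //.
  by rewrite -(PQ_fix1 g) PQ_lt.
have [a [_ a0 ga]] := PQ_rslope g q.
rewrite -[l](mulKf (lt0r_neq0 a0)) [a * l]mulrC; apply: rslopeM.
- exact: mulr_gt0.
- by rewrite PQ_M hid //; exact: rslopeV.
- exact: rslopeM.
Qed.

Lemma contracts_exp_id h p l n x : contracts h p l -> x <= p -> (h ^+ n)%g x = x.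
Proof. by move=> [hid _ _] xp; elim: n => // n IH; rewrite expgM1 IH hid. Qed.

(* The infimum of the orbit of q is fixed by h, hence it is p. *)
Lemma contracts_exp h p l q e : contracts h p l -> q < 1 -> 0 < e ->
  exists n, forall x, x <= q -> (h ^+ n)%g x <= p + e.
Proof.
move=> hp q1 e0; have [hid hc _] := hp.
suff [n hn] : exists n, (h ^+ n)%g q <= p + e.
  by exists n => x xq; apply: le_trans hn; rewrite PQ_le.
have [qp|pq] := leP q p; first by exists 0%N; rewrite PQ_1; lra.
pose E := [set (h ^+ n)%g q | n in setT].
have E0 : E !=set0 by exists q, 0%N.
have El : lbound E p.
  move=> _ [n _ <-]; rewrite -(contracts_exp_id n hp (lexx p)).
  by rewrite PQ_le ltW.
have Eb : has_lbound E by exists p.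
have pc : p <= inf E by exact: lb_le_inf.
have c1 : inf E < 1 by apply: le_lt_trans q1; apply: ge_inf => //; exists 0%N.
have [||_ [n _ <-] nE] := @inf_lt _ E (p + e) => //; last by exists n; exact: ltW.
suff : inf E <= p by lra.
rewrite leNgt; apply/negP => pc'.
(* An orbit point below [h^-1 (inf E)] would be sent by [h] to an orbit point below [inf E]. *)
have : inf E < (h^-1)%g (inf E) by rewrite -[ltLHS](PQ_K h) PQ_lt hc.
move=> /(inf_lt E0)[_ [n _ <-]].
rewrite -(PQ_lt h) PQ_VK -expgM1 ltNge => /negP; apply.
by apply: ge_inf => //; exists n.+1.
Qed.

End PQElements.

(** * Classful subgroups *)

Lemma contracts_exists (R : realType) (p l : R) : p \in ratnum -> l \in ratnum ->
  0 <= p -> p < 1 -> 0 < l -> l < 1 -> exists g : PQ R, contracts g p l.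
Proof.
move=> pQ lQ p0 p1 l0 l1.
exists (MkPQ (bend_PQ pQ lQ p0 p1 l0 l1)); split=> [x xp|x px x1|] /=.
- by apply: bend_out => //; left.
- exact: bend_contracts.
exists ((1 - p) / 2); first by rewrite divr_gt0 ?subr_gt0.
move=> t /andP[t0 tp]; rewrite (bend_out p0 p1 l0 l1 (or_introl (lexx p))).
by rewrite bend_mid //; [ring|lra|lra].
Qed.

Section Classful.
Variables (R : realType) (H : groupClosed (PQ R)).
Hypothesis H_classful : classful H.
Implicit Types (f g h k : PQ R) (a b l p q t x y z d e : R).

Lemma classful_contracts p l : p \in ratnum -> l \in ratnum ->
  0 <= p -> p < 1 -> 0 < l -> l < 1 ->
  exists h q, [/\ h \in H, q \in ratnum, contracts h q l, (q == 0) = (p == 0) &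
    0 <= q < 1].
Proof.
move=> pQ lQ p0 p1 l0 l1; have [g gp] := contracts_exists pQ lQ p0 p1 l0 l1.
have [x gxH] := H_classful g; exists (g ^ x)%g, ((x^-1)%g p); split=> //.
- exact: PQ_rat.
- by apply: contractsJ => //; rewrite PQ_VK.
- by rewrite -[in LHS](PQ_fix0 (x^-1)%g) (can_eq (PQ_VK x)).
- by rewrite -{1}(PQ_fix0 (x^-1)%g) -(PQ_fix1 (x^-1)%g) PQ_le PQ_lt p0.
Qed.

(** * Homotheties, transitivity and contractions in [H] *)

Definition homotheties p e := forall l, l \in ratnum -> 0 < l ->
  exists2 k, k \in H & forall t, 0 <= t <= e -> l * t <= e -> k (p + t) = p + l * t.

(** The range where a contraction of slope [l] is linear depends on [l]. Conjugating by a power of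
    one fixed contraction [h] of slope 1/2 extends it to [[p, p + e]]: there [h] is linear, and
    homotheties of the same center commute. Ratios above 1 come from inverses. *)
Lemma homothety p : p < 1 ->
  (forall l, l \in ratnum -> 0 < l -> l < 1 -> exists2 h, h \in H & contracts h p l) ->
  exists e, [/\ e \in ratnum, 0 < e, p + e < 1 & homotheties p e].
Proof.
move=> p1 hp.
have half : (2^-1 : R) \in ratnum by rewrite rpredV rpred_nat.
have [||h hH hc] := hp 2^-1 half; [lra|lra|].
have [hid _ [d d0 hd]] := hc.
have [e eQ /andP[e0]] : exists2 e, e \in ratnum & 0 < e < Num.min d (1 - p).
  by apply: ratnum_between; rewrite lt_min d0 subr_gt0.
rewrite lt_min => /andP[ed ep]; exists e; split=> //; first lra.
have hn n t : 0 <= t <= e -> (h ^+ n)%g (p + t) = p + 2^-1 ^+ n * t.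
  move=> /andP[t0 te]; elim: n => [|n IH]; first by rewrite mul1r.
  rewrite expgM1 IH hd ?hid //; first by rewrite mulrA -exprS.
  rewrite mulr_ge0 ?exprn_ge0 ?invr_ge0 //= (le_trans _ (le_trans te (ltW ed))) //.
  by rewrite ler_piMl // exprn_ile1 ?invr_ge0 // invf_le1 // ler1n.
have contraction l : l \in ratnum -> 0 < l -> l < 1 ->
    exists2 k, k \in H & forall t, 0 <= t <= e -> k (p + t) = p + l * t.
  move=> lQ l0 l1; have [k kH [kid kc [c c0 kl]]] := hp l lQ l0 l1.
  have [|n nE] := @contracts_exp _ h p _ (p + e) c hc _ c0; first lra.
  exists ((h ^+ n)^-1 * (k * h ^+ n))%g.
    by rewrite !gpredM ?gpredV ?gpredXn.
  move=> t /andP[t0 te]; rewrite !PQ_M.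
  rewrite hn ?t0 // kl ?kid //; last first.
    rewrite mulr_ge0 ?exprn_ge0 ?invr_ge0 //= -(lerD2l p) -hn ?t0 //.
    by apply: nE; rewrite lerD2l.
  rewrite mulrCA -hn ?PQ_K // mulr_ge0 ?(ltW l0) //=.
  by apply: le_trans te; rewrite ler_piMl ?(ltW l1).
move=> l lQ l0; have [l1|l1|->] := ltgtP l 1.
- by have [k kH kE] := contraction l lQ l0 l1; exists k => // t te _; exact: kE.
- have [|||k kH kE] := contraction l^-1; rewrite ?rpredV ?invr_gt0 ?invf_lt1 //.
  exists (k^-1)%g; first by rewrite gpredV.
  move=> t /andP[t0 te] lt; rewrite -{1}(mulKf (lt0r_neq0 l0) t) -kE ?PQ_K //.
  by rewrite mulr_ge0 // ltW.
- by exists 1%g => [|t _ _]; rewrite ?gpred1 // PQ_1 mul1r.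
Qed.

Lemma contracts_at0 l : l \in ratnum -> 0 < l -> l < 1 ->
  exists2 h, h \in H & contracts h 0 l.
Proof.
move=> lQ l0 l1.
have [h [q [hH _ hc]]] := classful_contracts (rpred0 ratnum) lQ (lexx 0) ltr01 l0 l1.
by rewrite eqxx => /eqP q0; exists h => //; rewrite -q0.
Qed.

(** A power of a contraction towards 0 brings [x] and [y] into the range of the homotheties of
    center 0, one of which maps the first image to the second. *)
Lemma H_transitive x y : x \in ratnum -> y \in ratnum ->
  0 < x -> x < 1 -> 0 < y -> y < 1 -> exists2 h, h \in H & h x = y.
Proof.
move=> xQ yQ x0 x1 y0 y1.
have [e [eQ e0 _ he]] := homothety ltr01 contracts_at0.
have [|||f fH fc] := @contracts_at0 2^-1; [by rewrite rpredV rpred_nat|lra|lra|].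
have [|n nE] := @contracts_exp _ f 0 _ (Num.max x y) e fc _ e0.
  by rewrite gt_max x1.
have fx0 : 0 < (f ^+ n)%g x by rewrite -(PQ_fix0 (f ^+ n)%g) PQ_lt.
have fy0 : 0 < (f ^+ n)%g y by rewrite -(PQ_fix0 (f ^+ n)%g) PQ_lt.
have [||k kH kE] := he ((f ^+ n)%g y / (f ^+ n)%g x).
- by rewrite rpred_div ?PQ_rat.
- exact: divr_gt0.
exists ((f ^+ n)^-1 * (k * f ^+ n))%g.
  by rewrite !gpredM ?gpredV ?gpredXn.
rewrite !PQ_M -[in LHS](add0r ((f ^+ n)%g x)) kE ?divfK ?lt0r_neq0 ?add0r ?PQ_K //.
  by rewrite ltW //= -[e]add0r nE // le_max lexx.
by rewrite -[e]add0r nE // le_max lexx orbT.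
Qed.

(** Classfulness gives a contraction in [H] at an uncontrolled rational point [q]; transitivity
    allows conjugating it within [H] to one at [p]. *)
Lemma H_contracts p l : p \in ratnum -> 0 <= p -> p < 1 ->
  l \in ratnum -> 0 < l -> l < 1 -> exists2 h, h \in H & contracts h p l.
Proof.
move=> pQ p0 p1 lQ l0 l1; have [->|pn0] := eqVneq p 0; first exact: contracts_at0.
have [h [q [hH qQ hc q0 /andP[q0' q1]]]] := classful_contracts pQ lQ p0 p1 l0 l1.
have p_gt0 : 0 < p by rewrite lt_def pn0.
have q_gt0 : 0 < q by rewrite lt_def q0 pn0.
have [k kH kp] := H_transitive pQ qQ p_gt0 p1 q_gt0 q1.
by exists (h ^ k)%g; [exact: gpredJ|apply: contractsJ => //; rewrite kp].
Qed.

(** * Prescribed right slopes and gluing *)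

Lemma H_right_slope p a : p \in ratnum -> 0 <= p -> p < 1 -> a \in ratnum -> 0 < a ->
  exists h, [/\ h \in H, forall x, x <= p -> h x = x & rslope h p a].
Proof.
move=> pQ p0 p1 aQ a0; have [a1|a1|->] := ltgtP a 1.
- by have [h hH [hid _ hs]] := H_contracts pQ p0 p1 aQ a0 a1; exists h.
- have [|||h hH [hid _ hs]] := @H_contracts p a^-1 pQ p0 p1.
    by rewrite rpredV.
    by rewrite invr_gt0.
    by rewrite invf_lt1.
  exists (h^-1)%g; split; first by rewrite gpredV.
    by move=> x xp; rewrite -{1}(hid x xp) PQ_K.
  rewrite -(hid p) // -[a]invrK; apply: rslopeV => //.
  by rewrite invr_gt0.
- exists 1%g; rewrite gpred1; split=> //.
  by exists 1 => // t _; rewrite !PQ_1 mul1r.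
Qed.

(* With d = k'^-1 k, an element of H trivial on [0, p] corrects the right slope
   of d at p to 1, making d trivial right of p near p; conjugating by an element
   trivial on [0, p] and contracting (p, 1) makes it trivial on [p, q]. *)
Lemma H_glue k k' p q : p \in ratnum -> 0 < p -> p < 1 -> q < 1 ->
  k \in H -> k' \in H -> k p = k' p ->
  exists2 h, h \in H &
    (forall x, x <= p -> h x = k x) /\ (forall x, p <= x -> x <= q -> h x = k' x).
Proof.
move=> pQ p0 p1 q1 kH k'H kk'.
pose d := (k'^-1 * k)%g.
have dH : d \in H by rewrite gpredM ?gpredV.
have dp : d p = p by rewrite PQ_M kk' PQ_K.
have [a [aQ a0 da]] := PQ_rslope d p.
have [||r [rH rid rs]] := H_right_slope pQ (ltW p0) p1 (a := a^-1).
- by rewrite rpredV.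
- by rewrite invr_gt0.
have half : (2^-1 : R) \in ratnum by rewrite rpredV rpred_nat.
have [||c cH cc] := H_contracts pQ (ltW p0) p1 half; [lra|lra|].
have drs : rslope (d * r)%g p 1.
  rewrite -(divff (lt0r_neq0 a0)); apply: rslopeM => //; first by rewrite invr_gt0.
  by rewrite rid.
have [e e0 eE] := drs.
have [n nE] := contracts_exp cc q1 e0.
(* Left of [p] the factors [c] and [r] are trivial, which leaves [k' * d], that is [k]; on [[p, q]]
   the conjugate of [d * r] is trivial, which leaves [k']. *)
exists (k' * ((c ^+ n)^-1 * (d * r * c ^+ n)))%g.
  by rewrite !gpredM ?gpredV ?gpredXn.
have cid x : x <= p -> (c ^+ n)%g x = x by exact: contracts_exp_id cc.
have cVid x : x <= p -> ((c ^+ n)^-1)%g x = x.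
  by move=> xp; rewrite -{1}(cid x xp) PQ_K.
split=> x.
  move=> xp; rewrite 2!PQ_M [(d * r * _)%g x]PQ_M cid // PQ_M rid // cVid; last first.
    by rewrite -dp PQ_le.
  by rewrite PQ_M PQ_VK.
move=> px xq; rewrite 2!PQ_M [(d * r * _)%g x]PQ_M.
have pcx : p <= (c ^+ n)%g x by rewrite -{1}(cid p) // PQ_le.
rewrite -{1}(subrKC p ((c ^+ n)%g x)) eE.
  by rewrite PQ_M rid // dp mul1r subrKC PQ_K.
by rewrite subr_ge0 pcx lerBlDl nE.
Qed.

(** * Affine maps between subintervals of a small interval *)

Definition affine_maps p e := forall a b, a \in ratnum -> b \in ratnum -> 0 < a ->
  exists2 k, k \in H & forall t, p <= t <= p + e -> p <= a * t + b <= p + e ->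
    k t = a * t + b.

(* The affine map is the composition of the homothety of ratio 1/w and center p,
   of a homothety of center 0, and of the homothety of ratio m and center p; for
   w large, the first one brings [p, p + e] close to p and m >= 1. *)
Lemma homotheties_affine p e E : p \in ratnum -> 0 < p -> p + e <= E ->
  homotheties 0 E -> homotheties p e -> affine_maps p e.
Proof.
move=> pQ p0 peE h0 hp a b aQ bQ a0.
pose tau := a * p + b - p.
have tauQ : tau \in ratnum by rewrite rpredB ?rpredD ?rpredM.
pose n := `|tau| / p.
have nQ : n \in ratnum.
  by rewrite rpred_div //; case: (ger0P tau) => _ //; rewrite rpredN.
have n0 : 0 <= n by rewrite divr_ge0 // ltW.
have tn : tau / p <= n by rewrite ler_pM2r ?invr_gt0 // ler_norm.
(* Chosen so that [a * w = a + 1 + n]; as [n >= tau / p], this gives [m >= 1]. *)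
pose w := 1 + (1 + n) / a.
have wQ : w \in ratnum by rewrite rpredD ?rpred1 ?rpred_div ?rpredD ?rpred1.
have w1 : 1 <= w by rewrite lerDl divr_ge0 ?(ltW a0) //; lra.
(* The ratio [a * w / m] has to send [p] to [p + tau / m], which the last homothety sends to
   [p + tau], the image of [p] under the affine map; this determines [m]. *)
pose m := a * w - tau / p.
have mQ : m \in ratnum by apply: rpredB; [exact: rpredM|exact: rpred_div].
have m1 : 1 <= m.
  have : a * w = a + 1 + n by rewrite /w; field; exact: lt0r_neq0.
  by rewrite /m => ->; lra.
have w0 : 0 < w by lra.
have m0 : 0 < m by lra.
have wVQ : w^-1 \in ratnum by rewrite rpredV.
have wV0 : 0 < w^-1 by rewrite invr_gt0.
have lQ : a * w / m \in ratnum by apply: rpred_div => //; exact: rpredM.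
have l0 : 0 < a * w / m by rewrite divr_gt0 ?mulr_gt0.
have [k1 k1H k1E] := hp _ wVQ wV0.
have [k2 k2H k2E] := h0 _ lQ l0.
have [k3 k3H k3E] := hp m mQ m0.
exists (k3 * (k2 * k1))%g; first by rewrite !gpredM.
move=> t /andP[pt te] /andP[pA Ae]; rewrite !PQ_M.
have u0 : 0 <= t - p by lra.
have wu : w^-1 * (t - p) <= t - p by rewrite ler_piMl // invf_le1.
have wu0 : 0 <= w^-1 * (t - p) by apply: mulr_ge0 => //; exact: ltW.
rewrite -{1}(subrKC p t) k1E; last 2 first.
- by rewrite u0 lerBlDl.
- by rewrite (le_trans wu) // lerBlDl.
have mid : a * w / m * (p + w^-1 * (t - p)) = p + (a * t + b - p) / m.
  have mE : p * m = a * w * p - tau by rewrite /m; field; exact: lt0r_neq0.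
  apply: (mulIf (lt0r_neq0 m0)); rewrite mulrDl divfK ?lt0r_neq0 // mE /tau.
  by field; rewrite !lt0r_neq0.
have A0 : 0 <= a * t + b - p by lra.
have Am : (a * t + b - p) / m <= a * t + b - p.
  by rewrite ler_pdivrMr // ler_peMr.
have Am0 : 0 <= (a * t + b - p) / m by apply: divr_ge0 => //; exact: ltW.
rewrite -[X in k2 X]add0r k2E ?mid; last 2 first.
- by apply/andP; split; lra.
- by lra.
rewrite add0r k3E ?[m * _]mulrC ?divfK ?subrKC ?lt0r_neq0 //; last by lra.
by apply/andP; split; lra.
Qed.

(** * From small pieces to initial segments *)

Definition movable p e c d := exists h a b, [/\ h \in H, a \in ratnum,
  b \in ratnum, 0 < a &
  {in `[c, d], forall t, h t = a * t + b /\ p <= a * t + b <= p + e}].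

(** A power [F] of a contraction towards 0 brings [[q, q']] into [[0, E]]. On a fine enough
    subdivision, the homothety of center 0 taking [F d] to [p + e] keeps the image of [c] above
    [p]. *)
Lemma movable_gaps p e E q q' : p \in ratnum -> e \in ratnum -> 0 < p -> 0 < e ->
  0 < E -> p + e <= E -> homotheties 0 E -> 0 < q -> q < q' -> q' < 1 ->
  exists2 s, {in s, forall z, z \in ratnum} & forall c d,
    c \in ratnum -> d \in ratnum -> q <= c -> c < d -> d <= q' ->
    gap s c d -> movable p e c d.
Proof.
move=> pQ eQ p0 e0 E0 peE hE q0 qq' q'1.
have half : (2^-1 : R) \in ratnum by rewrite rpredV rpred_nat.
have [||f fH fc] := contracts_at0 half; [lra|lra|].
have [n nE] := contracts_exp fc q'1 E0.
pose F := (f ^+ n)%g.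
have FH : F \in H by rewrite gpredXn.
have Fq0 : 0 < F q by rewrite -(PQ_fix0 F) PQ_lt.
have [r rQ /andP[r0 rq]] := ratnum_between Fq0.
(* Since [r <= F c], this step ensures [F d / F c <= (p + e) / p]. *)
have [||s2 s2Q s2P] := @mesh _ (r * e / p).
- by apply: rpred_div => //; exact: rpredM.
- by rewrite divr_gt0 ?mulr_gt0.
have [s1 s1Q s1P] := PQ_pieces F.
exists (s1 ++ map (F^-1)%g s2).
  by move=> z; rewrite mem_cat => /orP[/s1Q//|/mapP[u /s2Q uQ ->]]; rewrite PQ_rat.
move=> c d cQ dQ qc cd dq' /gap_cat[/(s1P c d cd)[a [b [aQ a0 ab]]] g2].
have Fc : r <= F c by apply: ltW; apply: lt_le_trans rq _; rewrite PQ_le.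
have Fcd : F c < F d by rewrite PQ_lt.
have FdE : F d <= E by rewrite -[E]add0r nE.
have step : F d <= F c + r * e / p.
  apply: s2P => //; first lra.
    by rewrite -(PQ_fix1 F) PQ_le; lra.
  move=> z zs; have := g2 _ (map_f _ zs); rewrite !in_itv /= -(PQ_lt F c) PQ_VK.
  by rewrite -(PQ_lt F _ d) PQ_VK.
have Fd0 : 0 < F d by lra.
pose l := (p + e) / F d.
have lQ : l \in ratnum by rewrite rpred_div ?rpredD ?PQ_rat.
have l0 : 0 < l by rewrite divr_gt0 //; lra.
have [k kH kE] := hE l lQ l0.
have bQ : b \in ratnum.
  have -> : b = F c - a * c by rewrite ab ?in_itv /= ?lexx ?ltW //; ring.
  by rewrite rpredB ?rpredM ?PQ_rat.
exists (k * F)%g, (l * a), (l * b); split;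
  [exact: gpredM|exact: rpredM|exact: rpredM|exact: mulr_gt0|].
move=> t tcd; have := tcd; rewrite in_itv /= => /andP[ct td].
have Fct : F c <= F t by rewrite PQ_le.
have Ftd : F t <= F d by rewrite PQ_le.
rewrite -mulrA -mulrDr -(ab t tcd).
have lt : l * F t <= p + e by rewrite mulrAC ler_pdivrMr // ler_pM2l //; lra.
rewrite -[X in k X]add0r kE ?add0r; [|lra|lra].
rewrite lt andbT; split=> //.
rewrite mulrAC ler_pdivlMr //.
have : p * F d <= p * (F c + r * e / p) by rewrite ler_pM2l.
have : p * F c + e * r <= (p + e) * F t.
  rewrite mulrDl; apply: lerD; first by rewrite ler_pM2l.
  by rewrite ler_pM2l // (le_trans Fc).
suff -> : p * (F c + r * e / p) = p * F c + e * r by move=> ? ?; lra.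
by field; exact: lt0r_neq0.
Qed.

(** By gluing at division points, it suffices to treat a piece [[c, d]] where [g] is affine and from
    which, as from [[g c, g d]], elements [h1] and [h2] of [H] lead affinely into [[p, p + e]].
    There [h2 * g * h1^-1] is an affine map realized in [H]. *)
Lemma H_agrees_between g q q' : q \in ratnum -> q' \in ratnum ->
  0 < q -> q < q' -> q' < 1 ->
  exists2 h, h \in H & forall t, q <= t <= q' -> h t = g t.
Proof.
move=> qQ q'Q q0 qq' q'1.
have [E [EQ E0 E1 hE]] := homothety ltr01 contracts_at0.
(* A second center, with [[p, p + e]] inside [[0, E]] for small [e]. *)
pose p := E / 2.
have pQ : p \in ratnum by rewrite rpred_div ?rpred_nat.
have p0 : 0 < p by rewrite divr_gt0.
have p1 : p < 1 by rewrite /p; lra.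
have [e' [_ e'0 _ he']] := homothety p1 (fun l => H_contracts pQ (ltW p0) p1 (l := l)).
have [e eQ /andP[e0]] : exists2 e, e \in ratnum & 0 < e < Num.min e' p.
  by apply: ratnum_between; rewrite lt_min e'0.
rewrite lt_min => /andP[ee' ep].
have he : homotheties p e.
  move=> l lQ l0; have [k kH kE] := he' l lQ l0; exists k => // t /andP[t0 te] lte.
  by rewrite kE ?t0 //; apply: le_trans (ltW ee').
have peE : p + e <= E by rewrite /p in ep *; lra.
have hA := homotheties_affine pQ p0 peE hE he.
have [s1 s1Q s1P] := movable_gaps pQ eQ p0 e0 E0 peE hE q0 qq' q'1.
have gq0 : 0 < g q by rewrite -(PQ_fix0 g) PQ_lt.
have gqq' : g q < g q' by rewrite PQ_lt.
have gq'1 : g q' < 1 by rewrite -(PQ_fix1 g) PQ_lt.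
have [s2 s2Q s2P] := movable_gaps pQ eQ p0 e0 E0 peE hE gq0 gqq' gq'1.
have [s3 s3Q s3P] := PQ_pieces g.
pose s := s1 ++ map (g^-1)%g s2 ++ s3.
have sQ : {in s, forall z, z \in ratnum}.
  move=> z; rewrite !mem_cat => /or3P[/s1Q//|/mapP[u /s2Q uQ ->]|/s3Q//].
  by rewrite PQ_rat.
suff agree : forall c d, c < d -> c \in ratnum -> d \in ratnum -> q <= c -> d <= q' ->
    exists2 h, h \in H & forall t, c <= t <= d -> h t = g t by exact: agree.
apply: (@gap_ind R s) => [c z d /sQ zQ cz zd IHc IHd cQ dQ qc dq'|c d cd].
  have zq' : z <= q' by lra.
  have qz : q <= z by lra.
  have [z0 z1 d1] : [/\ 0 < z, z < 1 & d < 1] by split; lra.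
  have [h hH hg] := IHc cQ zQ qc zq'.
  have [h' h'H h'g] := IHd zQ dQ qz dq'.
  have [|h'' h''H [hl hr]] := H_glue zQ z0 z1 d1 hH h'H.
    by rewrite hg ?h'g ?lexx ?ltW.
  exists h'' => // t /andP[ct td]; have [tz|zt] := leP t z.
    by rewrite hl // hg ?ct.
  by rewrite hr ?h'g ?(ltW zt).
move=> /gap_cat[/s1P c1 /gap_cat[g2 /(s3P c d cd)[a [b [aQ a0 ab]]]]] cQ dQ qc dq'.
have [h1 [a1 [b1 [h1H a1Q b1Q a10 h1E]]]] := c1 cQ dQ qc cd dq'.
have [||||||h2 [a2 [b2 [h2H a2Q b2Q a20 h2E]]]] := s2P (g c) (g d);
  rewrite ?PQ_rat ?PQ_le ?PQ_lt //.
  move=> z zs; have := g2 _ (map_f _ zs); rewrite !in_itv /=.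
  by rewrite -(PQ_lt g c) PQ_VK -(PQ_lt g _ d) PQ_VK.
have bQ : b \in ratnum.
  have -> : b = g c - a * c by rewrite ab ?in_itv /= ?lexx ?ltW //; ring.
  by apply: rpredB; [exact: PQ_rat|exact: rpredM].
(* The slope of [h2 * g * h1^-1] on the image of [[c, d]]; its constant term is
   [a2 * b + b2 - r * b1]. *)
pose r := a2 * a / a1.
have rQ : r \in ratnum by apply: rpred_div => //; exact: rpredM.
have r0 : 0 < r by rewrite divr_gt0 ?mulr_gt0.
have cQ' : a2 * b + b2 - r * b1 \in ratnum.
  by apply: rpredB; [apply: rpredD => //|]; exact: rpredM.
have [k kH kE] := hA _ _ rQ cQ' r0.
exists (h2^-1 * (k * h1))%g; first by rewrite !gpredM ?gpredV.
move=> t tcd; have [h1t J1] := h1E t tcd.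
have [|h2t J2] := h2E (g t); first by rewrite in_itv /= !PQ_le.
have A : r * (a1 * t + b1) + (a2 * b + b2 - r * b1) = a2 * g t + b2.
  by rewrite ab // /r; field; exact: lt0r_neq0.
by rewrite !PQ_M h1t kE ?A // -h2t PQ_K.
Qed.

(** Near 0, [g] is determined by its right slope at 0, which some element of [H] shares; that
    element is glued at [q0] to one agreeing with [g] on [[q0, q2]]. *)
Lemma H_agrees g q : q < 1 ->
  exists2 h, h \in H & forall t, t <= q -> h t = g t.
Proof.
move=> q1; have [a [aQ a0 [d d0 gE]]] := PQ_rslope g 0.
have [r [rH _ [d' d'0 rE]]] := H_right_slope (rpred0 ratnum) (lexx 0) ltr01 aQ a0.
have [q0 q0Q /andP[q00]] : exists2 x, x \in ratnum & 0 < x < Num.min (Num.min d d') 1.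
  by apply: ratnum_between; rewrite !lt_min d0 d'0 ltr01.
rewrite !lt_min => /andP[/andP[q0d q0d'] q01].
have [q2 q2Q /andP[]] : exists2 x, x \in ratnum & Num.max q q0 < x < 1.
  by apply: ratnum_between; rewrite gt_max q1.
rewrite gt_max => /andP[qq2 q0q2] q21.
have [h hH hg] := H_agrees_between g q0Q q2Q q00 q0q2 q21.
have rg t : t <= q0 -> r t = g t.
  move=> tq; have [t0|t0] := leP t 0; first by rewrite !PQ_out; [|left|left].
  rewrite -[t]add0r rE ?gE ?PQ_fix0 //; apply/andP; split; lra.
have [|h' h'H [hl hr]] := H_glue q0Q q00 q01 q21 rH hH.
  by rewrite rg // hg // lexx ltW.
exists h' => // t tq; have [tq0|q0t] := leP t q0; first by rewrite hl ?rg.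
by rewrite hr ?hg ?(ltW q0t) // ltW // (le_lt_trans tq).
Qed.

(** Some [c ^ x] lies in [H], and some [y] in [H] agrees with [x^-1] up to [q]. Conjugating by [y]
    undoes [x] up to [q], a range that [c] preserves; beyond [q] everything is trivial. *)
Lemma H_fix_near1 (c : PQ R) q : q < 1 -> (forall t, q <= t -> c t = t) -> c \in H.
Proof.
move=> q1 cq; have [x cxH] := H_classful c.
have [y yH yx] := H_agrees (x^-1)%g q1.
have -> : c = ((y^-1) * (c ^ x * y))%g; last first.
  by apply: gpredM; [rewrite gpredV|exact: gpredM].
apply: PQ_ext => t; rewrite conjgE !PQ_M; have [tq|qt] := leP t q.
  rewrite yx // PQ_VK -yx ?PQ_K //.
  by rewrite -(cq q (lexx q)) PQ_le.
(* Here [y t > y q = x^-1 q], hence [x (y t) > q]. *)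
rewrite cq ?PQ_K ?cq ?PQ_K // ltW //.
by rewrite -(PQ_lt y) yx // -(PQ_lt x) PQ_VK in qt.
Qed.

(** Germs at 1 are homotheties of center 1 and commute, so [g ^ x] and [g] agree near 1 and
    [g ^ x * g^-1] is trivial there. *)
Lemma classful_full g : g \in H.
Proof.
have [x gxH] := H_classful g.
have [a [d [a0 d0 gE]]] := PQ_lslope1 g.
have [b [d' [b0 d'0 xE]]] := PQ_lslope1 x.
(* For [s <= e], both [g (x (1 - s))] and [x (g (1 - s))] are computed within the linear ranges of
   [g] and [x]. *)
pose e := Num.min (Num.min d d') (Num.min (d / b) (d' / a)).
have e0 : 0 < e by rewrite !lt_min d0 d'0 !divr_gt0.
suff : (g ^ x * g^-1)%g \in H by rewrite gpredMl // gpredV.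
have q1 : g (1 - e) < 1 by rewrite -[ltRHS](PQ_fix1 g) PQ_lt; lra.
apply: (H_fix_near1 q1) => u; rewrite -(PQ_VK g u) PQ_le; set t := (g^-1)%g u => te.
rewrite PQ_M PQ_K conjgE !PQ_M -[RHS](PQ_K x); congr ((x^-1)%g _).
have [t1|t1] := leP 1 t; first by rewrite (PQ_out x) ?(PQ_out g) ?(PQ_out x); auto.
have s0 : 0 <= 1 - t by lra.
have : 1 - t <= e by lra.
rewrite !le_min !ler_pdivlMr // => /andP[/andP[sd sd'] /andP[sbd sad']].
have -> : t = 1 - (1 - t) by rewrite subKr.
rewrite xE ?gE ?xE ?s0 ?sd ?sd' //; first by ring.
- by rewrite mulrC sad' mulr_ge0 // ltW.
- by rewrite mulrC sbd mulr_ge0 // ltW.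
Qed.

End Classful.

Theorem theorem4 (R : realType) : invariably_generated (PQ R).
Proof. by move=> H H_classful g; rewrite (classful_full H_classful). Qed.
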